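(* For $n = 2,3,4,5,6,7,8,9,10$, the number $V_n$ of virtual $n$-crossings up to rotation is respectively $$2,\; 5,\; 20,\; 101,\; 684,\; 5377,\; 49342,\; 510745,\; 5894550.$$
   Context: A virtual $n$-crossing consists of $n$ unoriented straight strands $\alpha_1,\dots,\alpha_n$, labeled in clockwise order, through a common point in the plane. Each pair of distinct strands crosses either classically or virtually, subject to the validity condition that no three strands have exactly one virtual pair and two classical pairs among their three pairs; equivalently, the relation ''$\alpha_i = \alpha_j$ or $\alpha_i,\alpha_j$ cross classically'' is an equivalence relation on $\{\alpha_1,\dots,\alpha_n\}$. The strands pass through the crossing at distinct heights, but heights matter only for determining which strand is over in each classically crossing pair. Thus a labeled virtual $n$-crossing is the same as a partition of $\{\alpha_1,\dots,\alpha_n\}$ into nonempty parts together with a linear order (by height) on each part; the parts themselves are not ordered. Two labeled virtual $n$-crossings are the same up to rotation if one is obtained from the other by a cyclic shift of labels $\alpha_i \mapsto \alpha_{i+r}$ (indices modulo $n$). $V_n$ denotes the number of equivalence classes of labeled virtual $n$-crossings under rotation. *)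

(* Defs.v *)
From mathcomp Require Import all_boot.

Set Implicit Arguments.
Unset Strict Implicit.
Unset Printing Implicit Defensive.

Definition strict_linear_order_on (T : finType) (B : {set T}) (r : rel T) : bool :=
  [&& [forall x in B, ~~ r x x],
      [forall x in B, forall y in B, forall z in B, r x y && r y z ==> r x z] &
      [forall x in B, forall y in B, (x != y) ==> r x y || r y x]].

(* The strands are the elements of 'I_n, in clockwise order.  A crossing is
   encoded as a pair [c]: [c.1] is the set of parts (two distinct strands cross
   classically iff they are in the same part), and [(i, j) \in c.2] means that
   i and j cross classically with i over j. *)
Definition crossing_data (n : nat) : finType :=
  ({set {set 'I_n}} * {set 'I_n * 'I_n})%type.

Definition over (n : nat) (c : crossing_data n) : rel 'I_n :=
  [rel i j | (i, j) \in c.2].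

(* The last clause makes [c.2] carry no information beyond the orders on the
   parts. *)
Definition is_virtual_crossing (n : nat) (c : crossing_data n) : bool :=
  [&& partition c.1 [set: 'I_n],
      [forall B in c.1, strict_linear_order_on B (over c)] &
      [forall i, forall j, over c i j ==>
         [exists B in c.1, (i \in B) && (j \in B)]]].

Definition virtual_crossings (n : nat) : {set crossing_data n} :=
  [set c | is_virtual_crossing c].

(* [ordS] is the cyclic successor on 'I_n, so this is i |-> i + r modulo n. *)
Definition shift (n r : nat) (i : 'I_n) : 'I_n := iter r (@ordS n) i.

Definition rotate_crossing (n r : nat) (c : crossing_data n) : crossing_data n :=
  ([set [set shift r i | i in B] | B : {set 'I_n} in c.1],
   [set (shift r p.1, shift r p.2) | p in c.2]).

(* Shifts only depend on r modulo n, so r may range over 'I_n. *)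
Definition rotation_equiv (n : nat) : rel (crossing_data n) :=
  [rel c d | [exists r : 'I_n, d == rotate_crossing r c]].

Definition V (n : nat) : nat :=
  #|equivalence_partition (@rotation_equiv n) (virtual_crossings n)|.

(* Main.v *)
(* A crossing is determined by the relation [over], a strict order in which
   being equal or comparable is an equivalence.  By Burnside's lemma, n V_n is
   the sum over the rotations s of the number of such relations on 'I_n that
   are invariant under the group H generated by s, and H acts freely.

   Let N(m) be the number of H-invariant relations on m free orbits, d = #|H|,
   and D(m) the number of those on m + 1 orbits in which a given strand x is
   minimal.  The orbit of x is an antichain, so if x is not minimal it has an
   immediate predecessor in one of the m other orbits, whose choice leaves N(m)
   relations once the orbit of x is deleted: N(m + 1) = D(m) + m d N(m).  In the
   same way, looking at the immediate successor y of a minimal x and deleting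
   the orbit of y, D(m) = N(m) + m d D(m - 1). *)
Require Import Defs.
From Stdlib Require Import NArith Lia.
From mathcomp Require Import all_boot all_fingroup cyclic.

Set Implicit Arguments.
Unset Strict Implicit.
Unset Printing Implicit Defensive.

(** * Bijections and covering relations *)

Lemma eq_card_cancel_in (aT rT : finType) (A : {set aT}) (B : {set rT})
    (f : aT -> rT) (g : rT -> aT) :
  {in A, forall x, f x \in B} -> {in B, forall y, g y \in A} ->
  {in A, cancel f g} -> {in B, cancel g f} -> #|A| = #|B|.
Proof.
move=> fAB gBA fK gK; rewrite -(card_in_imset (can_in_inj fK)).
apply: eq_card => y; apply/imsetP/idP=> [[x xA ->] | yB]; first exact: fAB.
by exists (g y); rewrite ?gK ?gBA.
Qed.

Definition covers (T : finType) (r : rel T) (x y : T) : bool :=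
  r x y && [forall z, ~~ (r x z && r z y)].

Lemma coversP (T : finType) (r : rel T) x y :
  reflect (r x y /\ forall z, r x z -> r z y -> False) (covers r x y).
Proof.
apply: (iffP andP) => [[rxy /forallP cov] | [rxy cov]]; split=> //.
  by move=> z rxz rzy; have:= cov z; rewrite rxz rzy.
by apply/forallP=> z; apply/negP=> /andP[]; apply: cov.
Qed.

Lemma covers_converse (T : finType) (r : rel T) x y :
  covers (fun u v => r v u) x y = covers r y x.
Proof. by congr (_ && _); apply: eq_forallb => z; rewrite andbC. Qed.

(** The elements above [x] are pairwise comparable, so if there are any they have a least one, which
    is the only cover of [x]. Booleans are added as numbers: exactly one alternative holds. *)
Lemma sum_covers (T : finType) (r : rel T) (x : T) :
  irreflexive r -> transitive r ->
  (forall y z, r x y -> r x z -> [|| y == z, r y z | r z y]) ->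
  [forall y, ~~ r x y] + \sum_y covers r x y = 1.
Proof.
move=> rI rT rC; case: forallP => [xmax | /forallP].
  by rewrite big1 // => y _; rewrite /covers (negPf (xmax y)).
rewrite negb_forall => /existsP[y0]; rewrite negbK => rxy0.
(* Among the elements above [x], take one with the fewest predecessors: an element strictly between
   would have fewer still. *)
have [y rxy ymin] := arg_minnP (fun y => #|[set z | r z y]|) rxy0.
have cov_y : covers r x y.
  apply/coversP; split=> // z rxz rzy; have:= ymin z rxz.
  rewrite leqNgt proper_card //; apply/properP; split.
    by apply/subsetP=> w; rewrite !inE => /rT; apply.
  by exists z; rewrite inE ?rI.
rewrite (bigD1 y) //= cov_y big1 // => z z_ne_y.
apply/eqP; rewrite eqb0; apply/coversP=> -[rxz zcov].
have [_ ycov] := coversP _ _ _ cov_y.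
case/or3P: (rC _ _ rxy rxz) => [/eqP yz | ryz | rzy].
- by rewrite yz eqxx in z_ne_y.
- exact: zcov rxy ryz.
- exact: ycov rxz rzy.
Qed.

(** * Invariant disjoint unions of chains *)

Section ChainOrders.

Variables (T : finType) (H : {group {perm T}}).

Definition relof (R : {set T * T}) : rel T := fun x y => (x, y) \in R.

(** A strict order whose comparability components are chains. The support [A] is a parameter over a
    fixed carrier [T], so that orbits can be deleted without changing the type or the group. *)
Record chain_order (A : {set T}) (r : rel T) : Prop := ChainOrder {
  chain_dom : forall x y, r x y -> (x \in A) && (y \in A);
  chain_irr : irreflexive r;
  chain_trans : transitive r;
  chain_up : forall x y z, r x y -> r x z -> [|| y == z, r y z | r z y];
  chain_down : forall x y z, r y x -> r z x -> [|| y == z, r y z | r z y];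
  chain_inv : forall h, h \in H -> forall x y, r x y -> r (h x) (h y) }.

Definition chain_orderb (A : {set T}) (r : rel T) : bool :=
  [&& [forall x, forall y, r x y ==> (x \in A) && (y \in A)],
      [forall x, ~~ r x x],
      [forall y, forall x, forall z, r x y && r y z ==> r x z],
      [forall x, forall y, forall z,
         r x y && r x z || r y x && r z x ==> [|| y == z, r y z | r z y]] &
      [forall h in H, forall x, forall y, r x y ==> r (h x) (h y)]].

Lemma chain_orderP A r : reflect (chain_order A r) (chain_orderb A r).
Proof.
apply: (iffP and5P) => [[c1 c2 c3 c4 c6] | [c1 c2 c3 c4 c5 c6]]; split.
- by move=> x y; apply: (implyP (forallP (forallP c1 x) y)).
- by move=> x; apply: negPf (forallP c2 x).
- move=> y x z r1 r2; have:= forallP (forallP (forallP c3 y) x) z.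
  by rewrite r1 r2.
- move=> x y z r1 r2; have:= forallP (forallP (forallP c4 x) y) z.
  by rewrite r1 r2.
- move=> x y z r1 r2; have:= forallP (forallP (forallP c4 x) y) z.
  by rewrite r1 r2 orbT.
- move=> h hH x y.
  by apply: (implyP (forallP (forallP (forall_inP c6 h hH) x) y)).
- by apply/forallP=> x; apply/forallP=> y; apply/implyP; apply: c1.
- by apply/forallP=> x; rewrite c2.
- apply/forallP=> y; apply/forallP=> x; apply/forallP=> z.
  by apply/implyP=> /andP[]; apply: c3.
- apply/forallP=> x; apply/forallP=> y; apply/forallP=> z.
  by apply/implyP=> /orP[] /andP[r1 r2]; [apply: c4 r1 r2 | apply: c5 r1 r2].
- apply/forall_inP=> h hH; apply/forallP=> x; apply/forallP=> y.
  by apply/implyP; apply: c6.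
Qed.

Definition chain_orders A : {set {set T * T}} :=
  [set R | chain_orderb A (relof R)].

Definition stable (A : {set T}) :=
  forall h x, h \in H -> x \in A -> h x \in A.

Definition acts_freely := forall h x, h \in H -> h x = x -> h = 1%g.

Local Notation orb := (orbit 'P H).

Lemma stableD A x : stable A -> stable (A :\: orb x).
Proof.
move=> stA h u hH; rewrite !inE => /andP[uO uA].
by rewrite (stA h u hH uA) andbT -[h u]/('P%act u h) (orbit_actr _ _ _ hH).
Qed.

Lemma orbit_sub A x : stable A -> x \in A -> orb x \subset A.
Proof. by move=> stA xA; apply/subsetP=> _ /orbitP[h hH <-]; apply: stA. Qed.

Lemma orbPE u h x : h \in H -> (h u \in orb x) = (u \in orb x).
Proof. by move=> hH; rewrite -[h u]/('P%act u h) (orbit_actr _ _ _ hH). Qed.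

Lemma chain_invE A r h x y : chain_order A r -> h \in H ->
  r (h x) (h y) = r x y.
Proof.
move=> rA hH; apply/idP/idP; last exact: (chain_inv rA hH).
by move/(chain_inv rA (groupVr hH)); rewrite !permK.
Qed.

(* An element related to its image under h would be related to all its
   iterated images, hence to itself. *)
Lemma chain_orbit A r x y : chain_order A r -> r x y -> y \notin orb x.
Proof.
move=> rA rxy; apply/orbitP=> -[h hH hxy]; have {}hxy : h x = y by [].
subst y.
have iter_r k : r x ((h ^+ k.+1)%g x).
  elim: k => [|k IHk]; first by rewrite expg1.
  apply: (chain_trans rA rxy); rewrite expgSr permM.
  exact: (chain_inv rA hH IHk).
have:= iter_r #[h]%g.-1; rewrite prednK ?order_gt0 // expg_order perm1.
by rewrite (chain_irr rA).
Qed.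

Lemma free_inj h k x : acts_freely ->
  h \in H -> k \in H -> h x = k x -> h = k.
Proof.
move=> freeH hH kH hk; apply/eqP; rewrite eq_mulgV1; apply/eqP.
by apply: (freeH _ x); rewrite ?groupM ?groupV // permM hk permK.
Qed.

Lemma card_orb x : acts_freely -> #|orb x| = #|H|.
Proof.
move=> freeH; rewrite card_in_imset // => h k hH kH.
exact: free_inj freeH hH kH.
Qed.

(* Here y will be an immediate successor of x.  Then so is h y of h x for every
   h in H, and deleting the orbit of y loses no information: a chain order on
   the rest is expanded by inserting each h y just after h x. *)
Section Contraction.

Variables (A : {set T}) (x y : T).
Hypotheses (stA : stable A) (freeH : acts_freely).
Hypotheses (xA : x \in A) (yA : y \in A) (x_y : x \notin orb y).

Local Notation O := (orb y).
Local Notation A' := (A :\: O).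

(** Freeness makes the [h] found by [pick] unique, so this is the equivariant retraction onto the
    complement of [O] that carries [h y] to [h x]. *)
Definition collapse (u : T) : T :=
  if [pick h in H | h y == u] is Some h then h x else u.

Lemma collapse_out u : u \notin O -> collapse u = u.
Proof.
rewrite /collapse; case: pickP => // h /andP[hH /eqP <-].
by rewrite orbPE // orbit_refl.
Qed.

Lemma collapse_in h : h \in H -> collapse (h y) = h x.
Proof.
move=> hH; rewrite /collapse; case: pickP => [k /andP[kH /eqP kh] | /(_ h)].
  by rewrite (free_inj freeH kH hH kh).
by rewrite hH eqxx.
Qed.

Lemma orbE u : reflect (exists2 h, h \in H & u = h y) (u \in O).
Proof. by apply: (iffP orbitP) => -[h hH]; exists h. Qed.

Lemma collapse_stable h u : h \in H -> collapse (h u) = h (collapse u).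
Proof.
move=> hH; have [/orbE[k kH ->] | uO] := boolP (u \in O).
  by rewrite collapse_in // -!permM collapse_in ?groupM // permM.
by rewrite !collapse_out ?orbPE.
Qed.

Lemma collapse_notin u : collapse u \notin O.
Proof.
have [/orbE[k kH ->] | uO] := boolP (u \in O); last by rewrite collapse_out.
by rewrite collapse_in // orbPE.
Qed.

Lemma collapse_mem u : (collapse u \in A') = (u \in A).
Proof.
rewrite in_setD collapse_notin /=.
have [/orbE[k kH ->] | uO] := boolP (u \in O); last by rewrite collapse_out.
by rewrite collapse_in // !stA.
Qed.

(** Hence two distinct elements with the same image are some [h x] and [h y]; these are the pairs
    that a pull-back along [collapse] leaves unordered. *)
Lemma collapse_eq u v :
  collapse u = collapse v -> (u \in O) = (v \in O) -> u = v.
Proof.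
have [/orbE[k kH ->] | uO] := boolP (u \in O); last first.
  by move=> E /esym/negbT vO; rewrite !collapse_out in E.
move=> E /esym/orbE[h hH vE]; rewrite vE !collapse_in // in E *.
by rewrite (free_inj freeH kH hH E).
Qed.

Definition restrict (R : {set T * T}) := R :&: setX A' A'.

(** The pull-back of [R] along [collapse], together with the pairs [(h x, h y)], which the second
    alternative describes. *)
Definition expand (R : {set T * T}) : {set T * T} :=
  [set p | ((collapse p.1, collapse p.2) \in R) ||
           [&& p.1 \notin O, p.2 \in O & collapse p.1 == collapse p.2]
             && (p.1 \in A)].

Lemma relof_restrict R u v :
  relof (restrict R) u v = [&& relof R u v, u \in A' & v \in A'].
Proof. by rewrite /relof in_setI in_setX. Qed.

Lemma relof_expand R u v : relof (expand R) u v =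
  relof R (collapse u) (collapse v) ||
    [&& u \notin O, v \in O & collapse u == collapse v] && (u \in A).
Proof. by rewrite /relof inE. Qed.

Lemma restrict_chain R :
  chain_order A (relof R) -> chain_order A' (relof (restrict R)).
Proof.
move=> rA; split=> [u v|u|v u w|u v w|u v w|h hH u v]; rewrite !relof_restrict.
- by case/and3P=> _ -> ->.
- by rewrite (chain_irr rA).
- case/and3P=> r1 -> _ /and3P[r2 _ ->]; rewrite !andbT.
  exact: (chain_trans rA r1 r2).
- case/and3P=> r1 _ -> /and3P[r2 _ ->]; rewrite !andbT.
  exact: (chain_up rA r1 r2).
- case/and3P=> r1 -> _ /and3P[r2 -> _]; rewrite !andbT.
  exact: (chain_down rA r1 r2).
- case/and3P=> r1 uA vA; rewrite (chain_inv rA) //=.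
  by rewrite !(stableD stA).
Qed.

Lemma expand_chain R :
  chain_order A' (relof R) -> chain_order A (relof (expand R)).
Proof.
move=> rA.
have irr u : relof R u u = false by apply: chain_irr rA u.
have total u v : collapse u = collapse v -> u \in A ->
    [|| u == v, relof (expand R) u v | relof (expand R) v u].
  move=> E uA; have vA : v \in A by rewrite -collapse_mem -E collapse_mem.
  rewrite !relof_expand E irr uA vA eqxx /=.
  have [] := boolP (u \in O); have [] := boolP (v \in O); rewrite ?orbT //=.
    by move=> vO uO; rewrite (collapse_eq E) ?eqxx // vO uO.
  by move=> vO uO; rewrite (collapse_eq E) ?eqxx // (negPf vO) (negPf uO).
(* Comparable or equal images suffice for comparability; both chain conditions reduce to this. *)
have compare u v : [|| collapse u == collapse v,
      relof R (collapse u) (collapse v) | relof R (collapse v) (collapse u)] ->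
    u \in A -> [|| u == v, relof (expand R) u v | relof (expand R) v u].
  case/or3P=> [/eqP E|E|E] uA; first exact: total.
    by rewrite !relof_expand E orbT.
  by rewrite !relof_expand E !orbT.
have dom u v : relof (expand R) u v -> (u \in A) && (v \in A).
  rewrite relof_expand => /orP[/(chain_dom rA)|].
    by rewrite !collapse_mem.
  case/andP=> /and3P[_ _ /eqP E] uA.
  by rewrite uA -collapse_mem -E collapse_mem.
split=> [||v u w|u v w|u v w|h hH u v] //.
- by move=> u; rewrite relof_expand irr; case: (u \in O).
- rewrite !relof_expand => /orP[r1|/andP[/and3P[uO vO /eqP->] uA]].
    case/orP=> [r2|/andP[/and3P[_ _ /eqP<-] _]]; last by rewrite r1.
    by rewrite (chain_trans rA r1 r2).
  by case/orP=> [-> //|]; rewrite vO.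
- move=> ruv ruw; have /andP[_ vA] := dom _ _ ruv.
  apply: compare => //; move: ruv ruw; rewrite !relof_expand.
  case/orP=> [r1|/andP[/and3P[_ vO /eqP <-] _]].
    case/orP=> [r2|/andP[/and3P[_ _ /eqP <-] _]].
      exact: (chain_up rA r1 r2).
    by rewrite r1 !orbT.
  by case/orP=> [-> |/andP[/and3P[_ _ ->]]]; rewrite ?orbT.
- move=> ruv ruw; have /andP[vA _] := dom _ _ ruv.
  apply: compare => //; move: ruv ruw; rewrite !relof_expand.
  case/orP=> [r1|/andP[/and3P[_ _ /eqP E] _]].
    case/orP=> [r2|/andP[/and3P[_ _ /eqP ->] _]].
      exact: (chain_down rA r1 r2).
    by rewrite r1 !orbT.
  rewrite E; case/orP=> [-> |/andP[/and3P[_ _ /eqP ->]]]; rewrite ?orbT //.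
  by rewrite eqxx.
- rewrite !relof_expand !collapse_stable // (chain_invE _ _ rA hH) !orbPE //.
  rewrite (inj_eq perm_inj); case/orP=> [-> // | /andP[-> uA]].
  by rewrite (stA hH uA) orbT.
Qed.

(** By invariance every [h y] covers [h x], so the relations of [h y] with other elements are
    dictated by those of [h x]: [below] treats what lies under [h y], [above] what lies over it. *)
Lemma restrictK R : chain_order A (relof R) -> covers (relof R) x y ->
  expand (restrict R) = R.
Proof.
move=> rA /coversP[rxy cov].
have trans := chain_trans rA.
have irr u : relof R u u = false by apply: chain_irr rA u.
have covh h z : h \in H -> relof R (h x) z -> relof R z (h y) -> False.
  move=> hH; rewrite -[z](permKV h) !(chain_invE _ _ rA hH); exact: cov.
have rh h : h \in H -> relof R (h x) (h y).
  by move=> hH; apply: (chain_inv rA hH).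
have below u h : h \in H -> relof R u (h y) = relof R u (h x) || (u == h x).
  move=> hH; apply/idP/idP => [ruy | /orP[ruh | /eqP ->]]; last exact: rh.
    case/or3P: (chain_down rA ruy (rh h hH)) => [->|->|rhu] //.
      by rewrite orbT.
    by case: (covh h u hH rhu ruy).
  exact: trans ruh (rh h hH).
have above v h : h \in H -> v != h y -> relof R (h y) v = relof R (h x) v.
  move=> hH v_hy; apply/idP/idP => [| rhv]; first exact: trans (rh h hH).
  case/or3P: (chain_up rA rhv (rh h hH)) => [/eqP E|E|//].
    by rewrite E eqxx in v_hy.
  by case: (covh h v hH rhv E).
apply/setP=> -[u v]; rewrite -[LHS]/(relof _ u v) -[RHS]/(relof _ u v).
rewrite relof_expand relof_restrict !collapse_mem.
have -> : [&& relof R (collapse u) (collapse v), u \in A & v \in A] =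
          relof R (collapse u) (collapse v).
  apply/andb_idr=> /(chain_dom rA) /andP[uA vA].
  rewrite -[u \in A]collapse_mem -[v \in A]collapse_mem !in_setD.
  by rewrite !collapse_notin uA vA.
have [/orbE[k kH uE] | uO] := boolP (u \in O);
  have [/orbE[h hH vE] | vO] := boolP (v \in O); rewrite /= ?orbF.
- rewrite uE vE !collapse_in //.
  have [<- | kh] := eqVneq k h; first by rewrite !irr.
  (* Freeness separates [h] and [k] at every point: at [y], as [above] requires, and at [x], to
     discard the equality left by [below]. *)
  have ne u' : h u' != k u'.
    by apply: contraNneq kh => E; rewrite (free_inj freeH hH kH E).
  by rewrite above // below // eq_sym (negPf (ne x)) orbF.
- rewrite uE collapse_in // collapse_out // above //.
  by apply: contraNneq vO => ->; rewrite orbPE // orbit_refl.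
- rewrite vE collapse_in // collapse_out // below //.
  by case: eqP => [->|_]; rewrite ?stA ?orbF.
- by rewrite !collapse_out.
Qed.

Lemma expandK R : chain_order A' (relof R) -> restrict (expand R) = R.
Proof.
move=> rA; apply/setP=> -[u v].
rewrite -[LHS]/(relof _ u v) -[RHS]/(relof _ u v) relof_restrict relof_expand.
apply/idP/idP=> [/and3P[+ uA vA] | r1].
  move: uA vA; rewrite !in_setD => /andP[uO _] /andP[vO _].
  by rewrite !collapse_out // (negPf vO) andbF /= orbF.
have /andP[uA vA] := chain_dom rA r1; rewrite uA vA /=.
move: uA vA; rewrite !in_setD => /andP[uO _] /andP[vO _].
by rewrite !collapse_out // r1.
Qed.

(** Both [x] and [y] collapse to [x], so an element strictly between them would put [x] below itself
    in [R], or lie both in [O] and outside it. *)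
Lemma expand_covers R :
  chain_order A' (relof R) -> covers (relof (expand R)) x y.
Proof.
move=> rA; have irr u : relof R u u = false by apply: chain_irr rA u.
have cy : collapse y = x by rewrite -{1}[y](perm1 y) collapse_in // perm1.
apply/coversP; split.
  by rewrite relof_expand cy collapse_out // x_y orbit_refl eqxx xA orbT.
move=> z; rewrite !relof_expand cy (collapse_out x_y).
case/orP=> [r1|/andP[/and3P[_ zO /eqP E] _]].
  case/orP=> [r2|/andP[/and3P[_ _ /eqP E] _]].
    by have:= chain_trans rA r1 r2; rewrite irr.
  by rewrite E irr in r1.
by rewrite zO -E irr.
Qed.

Lemma card_covers :
  #|[set R in chain_orders A | covers (relof R) x y]| = #|chain_orders A'|.
Proof.
apply: (@eq_card_cancel_in _ _ _ _ restrict expand) => R; rewrite !inE.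
- by case/andP=> /chain_orderP rA _; apply/chain_orderP/restrict_chain.
- move/chain_orderP=> rA; rewrite expand_covers // andbT.
  by apply/chain_orderP/expand_chain.
- by case/andP=> /chain_orderP; apply: restrictK.
- by move/chain_orderP; apply: expandK.
Qed.

End Contraction.

(** * Recurrences for the number of chain orders *)

Definition minimal (r : rel T) x := [forall z, ~~ r z x].

Definition min_chain_orders A x :=
  [set R in chain_orders A | minimal (relof R) x].

(** The bijection of [card_covers] respects minimality of [x]: the inserted pairs only put elements
    below the orbit of [y], which does not contain [x]. *)
Lemma card_min_covers A x y : stable A -> acts_freely ->
  x \in A -> y \in A -> x \notin orb y ->
  #|[set R in min_chain_orders A x | covers (relof R) x y]|
    = #|min_chain_orders (A :\: orb y) x|.
Proof.
move=> stA freeH xA yA x_y.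
apply: (@eq_card_cancel_in _ _ _ _ (restrict A y) (expand A x y)) => R.
- rewrite !inE => /andP[/andP[/chain_orderP rA /forallP xmin] _].
  apply/andP; split; first exact/chain_orderP/restrict_chain.
  apply/forallP=> z; rewrite relof_restrict; apply: contra (xmin z).
  by case/and3P.
- rewrite !inE => /andP[/chain_orderP rA /forallP xmin].
  rewrite (expand_covers freeH) // andbT; apply/andP; split.
    exact/chain_orderP/expand_chain.
  apply/forallP=> z; rewrite relof_expand (collapse_out _ x_y) negb_or.
  by rewrite xmin (negPf x_y) andbF.
- rewrite !inE => /andP[/andP[/chain_orderP rA _]]; exact: restrictK.
- rewrite !inE => /andP[/chain_orderP rA _]; exact: expandK.
Qed.

(** By invariance the whole orbit of an isolated [x] is isolated, so the same set of pairs is a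
    chain order on the remaining elements. *)
Lemma card_isolated A x : stable A -> x \in A ->
  #|[set R in min_chain_orders A x | [forall z, ~~ relof R x z]]|
    = #|chain_orders (A :\: orb x)|.
Proof.
move=> stA xA; apply: eq_card => R; rewrite !inE.
apply/andP/chain_orderP=> [[/andP[/chain_orderP rA xmin] xmax] | rA].
  have out u v : relof R u v -> (u \notin orb x) && (v \notin orb x).
    move=> ruv; apply/andP; split; apply: contraTN ruv.
      case/orbitP=> h hH <-; rewrite -[v](permKV h) (chain_invE _ _ rA hH).
      exact: (forallP xmax).
    case/orbitP=> h hH <-; rewrite -[u](permKV h) (chain_invE _ _ rA hH).
    exact: (forallP xmin).
  case: (rA) => d0 ? ? ? ? ?; split=> // u v ruv; rewrite !in_setD.
  by have /andP[-> ->] := out _ _ ruv; apply: d0.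
split; last first.
  apply/forallP=> z; apply/negP=> /(chain_dom rA).
  by rewrite in_setD orbit_refl.
apply/andP; split.
  apply/chain_orderP; case: rA => d0 ? ? ? ? ?; split=> // u v /d0.
  by rewrite !in_setD => /andP[/andP[_ ->] /andP[_ ->]].
apply/forallP=> z; apply/negP=> /(chain_dom rA).
by rewrite [x \in _]in_setD orbit_refl andbF.
Qed.

(** Double counting: the hypothesis is summed over [S] and the two sums are exchanged. *)
Lemma card_split_covers (S : {set {set T * T}}) (bot : pred {set T * T})
    (cov : {set T * T} -> pred T) :
  {in S, forall R, bot R + \sum_y cov R y = 1} ->
  #|S| = #|[set R in S | bot R]| + \sum_y #|[set R in S | cov R y]|.
Proof.
move=> split1; rewrite -sum1_card -[in RHS]sum1_card.
under [X in _ = _ + X]eq_bigr => y _ do rewrite -sum1_card.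
have sumE (p : pred {set T * T}) :
    \sum_(R in [set R in S | p R]) 1 = \sum_(R in S) p R.
  rewrite big_mkcond [RHS]big_mkcond; apply: eq_bigr => R _.
  by rewrite inE; case: (R \in S); case: (p R).
rewrite sumE; under [X in _ = _ + X]eq_bigr => y _ do rewrite sumE.
rewrite exchange_big -big_split /=; apply: eq_bigr => R RS.
by rewrite split1.
Qed.

Lemma card_chain_orders_rec A x : stable A -> acts_freely -> x \in A ->
  #|chain_orders A| = #|min_chain_orders A x|
    + #|A :\: orb x| * #|chain_orders (A :\: orb x)|.
Proof.
move=> stA freeH xA.
rewrite (@card_split_covers _ (fun R => minimal (relof R) x)
           (fun R y => covers (relof R) y x)); last first.
  move=> R; rewrite inE => /chain_orderP rA.
  (* Immediate predecessors of [x] are its covers in the converse order. *)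
  under eq_bigr => y _ do rewrite -covers_converse.
  apply: (@sum_covers _ (fun u v => relof R v u)).
  - exact: chain_irr rA.
  - by move=> v u w r1 r2; apply: (chain_trans rA r2 r1).
  - move=> y z r1 r2; rewrite orbCA orbC -!orbA [X in _ || X]orbC.
    by have:= chain_down rA r1 r2; rewrite [_ || relof R z y]orbC.
(* Elements of the orbit of [x] are incomparable with [x] and those outside [A] are unrelated to it,
   so only [A :\: orb x] contributes. *)
congr (_ + _); rewrite (bigID (mem (A :\: orb x))) /= [X in _ + X]big1.
  rewrite addn0 -sum_nat_const; apply: eq_bigr => y.
  by rewrite in_setD => /andP[yx yA]; rewrite card_covers.
move=> y yA; apply: eq_card0 => R; rewrite !inE; apply: contraNF yA.
case/andP=> /chain_orderP rA /coversP[ryx _]; rewrite in_setD orbit_sym.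
by rewrite (chain_orbit rA ryx); case/andP: (chain_dom rA ryx).
Qed.

(** The deleted orbit is that of the successor [y], so [x] survives as a minimal element. The
    summands turn out equal once the count is known to depend only on the number of orbits. *)
Lemma card_min_chain_orders_rec A x : stable A -> acts_freely -> x \in A ->
  #|min_chain_orders A x| = #|chain_orders (A :\: orb x)|
    + \sum_(y in A :\: orb x) #|min_chain_orders (A :\: orb y) x|.
Proof.
move=> stA freeH xA.
rewrite (@card_split_covers _ (fun R => [forall z, ~~ relof R x z])
           (fun R y => covers (relof R) x y)); last first.
  move=> R; rewrite !inE => /andP[/chain_orderP rA _].
  apply: sum_covers; [exact: chain_irr rA | exact: chain_trans rA |].
  by move=> y z; apply: (chain_up rA).
rewrite card_isolated //; congr (_ + _).
rewrite (bigID (mem (A :\: orb x))) /= [X in _ + X]big1.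
  rewrite addn0; apply: eq_bigr => y.
  by rewrite in_setD orbit_sym => /andP[yx yA]; apply: card_min_covers.
move=> y yA; apply: eq_card0 => R; rewrite !inE; apply: contraNF yA.
case/andP=> /andP[/chain_orderP rA _] /coversP[rxy _].
by rewrite in_setD (chain_orbit rA rxy); case/andP: (chain_dom rA rxy).
Qed.

Lemma chain_orders0 : #|chain_orders set0| = 1.
Proof.
rewrite -(cards1 (set0 : {set T * T})); apply: eq_card => R; rewrite !inE.
apply/chain_orderP/eqP=> [rA | ->].
  apply/setP=> -[u v]; rewrite inE; apply/negP=> /(chain_dom rA).
  by rewrite inE.
by split=> [u v|u|v u w|u v w|u v w|h hH u v]; rewrite /relof inE.
Qed.

End ChainOrders.

(* The values are binary because they reach 58941091. *)
Fixpoint chain_counts (d m : nat) : N * N :=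
  if m is m'.+1 then
    let: (a, b) := chain_counts d m' in
    let a' := (b + N.of_nat (m' * d) * a)%num in
    (a', a' + N.of_nat (m * d) * b)%num
  else (1, 1)%num.

(** The components of [chain_counts] are N(m) and D(m), D(m) concerning m + 1 orbits. One induction
    gives both, since each recurrence calls on the other. *)
Lemma card_chain_orders (T : finType) (H : {group {perm T}}) m :
  acts_freely H ->
  (forall A : {set T}, stable H A -> #|A| = m * #|H| ->
     #|chain_orders H A| = N.to_nat (chain_counts #|H| m).1) /\
  (forall (A : {set T}) x, stable H A -> #|A| = m.+1 * #|H| -> x \in A ->
     #|min_chain_orders H A x| = N.to_nat (chain_counts #|H| m).2).
Proof.
move=> freeH.
have cardD k (A : {set T}) x : stable H A -> #|A| = k.+1 * #|H| -> x \in A ->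
    #|A :\: orbit 'P H x| = k * #|H|.
  move=> stA cA xA; rewrite cardsD (setIidPr (orbit_sub stA xA)) card_orb //.
  by rewrite cA mulSn addKn.
elim: m => [|m [IHN IHD]].
  split=> [A _ /eqP|A x stA cA xA].
    by rewrite mul0n cards_eq0 => /eqP->; apply: chain_orders0.
  rewrite card_min_chain_orders_rec // big1 ?addn0; last first.
    by move=> y; rewrite (cards0_eq (cardD _ _ _ stA cA xA)) inE.
  by rewrite (cards0_eq (cardD _ _ _ stA cA xA)) chain_orders0.
rewrite /=; case: chain_counts IHN IHD => a b /= IHN IHD.
rewrite !(N2Nat.inj_add, N2Nat.inj_mul, Nat2N.id, plusE, multE).
(* N(m + 1) comes first, from any [x] in the nonempty [A], because D(m + 1) uses it. *)
have NS (A : {set T}) : stable H A -> #|A| = m.+1 * #|H| ->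
    #|chain_orders H A| = N.to_nat b + m * #|H| * N.to_nat a.
  move=> stA cA; have /card_gt0P[x xA] : 0 < #|A|.
    by rewrite cA muln_gt0 cardG_gt0.
  rewrite (card_chain_orders_rec stA freeH xA) (IHD A x) // (cardD m) // IHN //.
    exact: stableD.
  exact: cardD.
split=> // A x stA cA xA; rewrite (card_min_chain_orders_rec stA freeH xA) NS.
- congr (_ + _); rewrite -(cardD m.+1 A x) // -sum_nat_const.
  apply: eq_bigr => y; rewrite in_setD orbit_sym => /andP[yx yA].
  by apply: IHD; rewrite ?in_setD ?yx //; [apply: stableD | apply: cardD].
- exact: stableD.
- exact: cardD.
Qed.

(** * Comparability as an equivalence relation *)

Definition linked (T : eqType) (r : rel T) : rel T :=
  fun x y => [|| x == y, r x y | r y x].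

(** Two steps in the same direction compose by transitivity of [r]; steps in opposite directions are
    the cases of [chain_up] and [chain_down]. *)
Lemma linked_equivalence (T : finType) (H : {group {perm T}}) A r :
  chain_order H A r -> equivalence_rel (linked r).
Proof.
move=> rA; have sym x y : linked r x y = linked r y x.
  by rewrite /linked eq_sym [r x y || _]orbC.
have tr : transitive (linked r).
  move=> y x z /or3P[/eqP -> //|xy|yx] /or3P[/eqP <-|yz|zy].
  - by rewrite /linked xy orbT.
  - by rewrite /linked (chain_trans rA xy yz) orbT.
  - exact: (chain_down rA xy zy).
  - by rewrite /linked yx !orbT.
  - exact: (chain_up rA yx yz).
  - by rewrite /linked (chain_trans rA zy yx) !orbT.
move=> x y z; split; first by rewrite /linked eqxx.
move=> xy; apply/idP/idP; last exact: tr.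
by apply: tr; rewrite sym.
Qed.

Lemma chain_order_sub (T : finType) (H K : {group {perm T}}) A r :
  K \subset H -> chain_order H A r -> chain_order K A r.
Proof. by move=> /subsetP KH [*]; split=> // h /KH; auto. Qed.

Lemma chain_order_preim (T : finType) (t : {perm T}) (r r' : rel T) :
  (forall u v, r' u v = r (t u) (t v)) ->
  chain_order 1%G [set: T] r -> chain_order 1%G [set: T] r'.
Proof.
move=> r'E [r1 r2 r3 r4 r5 r6].
split=> [u v|u|v u w|u v w|u v w|h /set1P-> u v]; rewrite ?inE ?perm1 ?r'E //.
- exact: r3.
- by rewrite -(inj_eq (@perm_inj _ t)); apply: r4.
- by rewrite -(inj_eq (@perm_inj _ t)); apply: r5.
Qed.

(** * Virtual crossings as chain orders *)

Section Crossings.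

Variable n : nat.
Implicit Types (c : crossing_data n) (s : {perm 'I_n}) (R : {set 'I_n * 'I_n}).

Definition parts R : {set {set 'I_n}} :=
  equivalence_partition (linked (relof R)) [set: 'I_n].

(** Heights are compared only inside a part and are total there, so the parts are the classes of
    [linked] and [c.2] determines the crossing. The trivial group makes the invariance clause
    void. *)
Lemma virtual_crossingE c : (c \in virtual_crossings n) =
  chain_orderb 1%G [set: 'I_n] (relof c.2) && (c.1 == parts c.2).
Proof.
case: c => P R; rewrite inE /is_virtual_crossing /=.
apply/and3P/andP=> [[partP /forall_inP ordP /forallP overP] |
                    [/chain_orderP rA /eqP ->]].
  have [/eqP covP tiP P0] := and3P partP.
  have memB x : x \in pblock P x by rewrite mem_pblock covP inE.
  have blkP x : pblock P x \in P by rewrite pblock_mem // covP inE.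
  have same x y : relof R x y -> pblock P x = pblock P y.
    move=> rxy; have /implyP/(_ rxy) := forallP (overP x) y.
    case/existsP=> B /and3P[BP xB yB].
    by rewrite (def_pblock tiP BP xB) (def_pblock tiP BP yB).
  have irr x : relof R x x = false.
    by have /and3P[/forall_inP/(_ x (memB x))/negPf] := ordP _ (blkP x).
  have total x y : pblock P x = pblock P y -> linked (relof R) x y.
    move=> E; have /and3P[_ _ /forall_inP/(_ x (memB x))] := ordP _ (blkP x).
    move=> /forall_inP/(_ y); rewrite {1}E memB => /(_ isT).
    by rewrite /linked; case: eqP.
  have rA : chain_order 1%G [set: 'I_n] (relof R).
    split=> [x y|//|y x z rxy ryz|x y z rxy rxz|x y z ryx rzx|h /set1P-> x y].
    - by rewrite !inE.
    - have /and3P[_ /forall_inP/(_ x) + _] := ordP _ (blkP y).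
      rewrite -{1}(same _ _ rxy) memB => /(_ isT)/forall_inP/(_ y (memB y)).
      move/forall_inP/(_ z); rewrite {1}(same _ _ ryz) memB => /(_ isT)/implyP.
      by apply; apply/andP.
    - by apply: total; rewrite -(same _ _ rxy) (same _ _ rxz).
    - by apply: total; rewrite (same _ _ ryx) (same _ _ rzx).
    - by rewrite !perm1.
  split; first exact/chain_orderP.
  rewrite -[P in P == _](equivalence_partition_pblock partP); apply/eqP.
  apply: eq_imset => x; apply/setP=> y; rewrite !inE /=.
  apply/idP/or3P=> [yB | ].
    by apply/or3P/total/esym/def_pblock.
  by case=> [/eqP-> | /same E | /same E]; rewrite ?E // -E.
have eqv := linked_equivalence rA.
have partR : partition (parts R) [set: 'I_n].
  by apply: equivalence_partitionP => x y z _ _ _; apply: eqv.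
split=> //.
  apply/forall_inP=> _ /imsetP[x _ ->]; apply/and3P; split.
  - by apply/forall_inP=> y _; apply: (negbT (chain_irr rA y)).
  - apply/forall_inP=> y _; apply/forall_inP=> z _; apply/forall_inP=> w _.
    by apply/implyP=> /andP[r1 r2]; apply: (chain_trans rA r1 r2).
  - apply/forall_inP=> y; rewrite !inE /= => xy; apply/forall_inP=> z.
    rewrite !inE /= => xz; apply/implyP=> yz.
    by move: xz; rewrite (eqv x y z).2 // /linked (negPf yz).
apply/forallP=> x; apply/forallP=> y; apply/implyP=> xy; apply/existsP.
exists [set z in [set: 'I_n] | linked (relof R) x z].
apply/and3P; split; first by apply/imsetP; exists x.
  by rewrite !inE (eqv x x x).1.
by rewrite !inE /linked (xy : relof R x y) orbT.
Qed.

Lemma crossing_chain c : c \in virtual_crossings n ->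
  chain_order 1%G [set: 'I_n] (relof c.2).
Proof. by rewrite virtual_crossingE => /andP[/chain_orderP]. Qed.

Lemma crossing_parts c : c \in virtual_crossings n -> c.1 = parts c.2.
Proof. by rewrite virtual_crossingE => /andP[_ /eqP]. Qed.

Definition crossing_act c s : crossing_data n :=
  ([set s @: B | B : {set 'I_n} in c.1], [set (s p.1, s p.2) | p in c.2]).

Lemma crossing_act1 : crossing_act^~ 1%g =1 id.
Proof.
case=> P R; congr (_, _).
  rewrite -[RHS]imset_id; apply: eq_imset => B.
  by rewrite -[RHS]imset_id; apply: eq_imset => x; rewrite perm1.
by rewrite -[RHS]imset_id; apply: eq_imset => -[x y]; rewrite !perm1.
Qed.

Lemma crossing_actM c : act_morph crossing_act c.
Proof.
move=> s t; congr (_, _).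
  rewrite -imset_comp; apply: eq_imset => B.
  by rewrite /= -imset_comp; apply: eq_imset => x; rewrite permM.
by rewrite -imset_comp; apply: eq_imset => -[x y] /=; rewrite !permM.
Qed.

Canonical crossing_action := TotalAction crossing_act1 crossing_actM.

Lemma relof_act c s u v :
  relof (crossing_act c s).2 u v = relof c.2 (s^-1 u)%g (s^-1 v)%g.
Proof.
apply/imsetP/idP=> [[[x y] xy [-> ->]] | uv]; first by rewrite !permK.
by exists ((s^-1 u)%g, (s^-1 v)%g); rewrite ?permKV.
Qed.

Lemma virtual_crossings_act c s :
  c \in virtual_crossings n -> crossing_act c s \in virtual_crossings n.
Proof.
move=> cV; rewrite virtual_crossingE; apply/andP; split.
  exact/chain_orderP/(chain_order_preim (relof_act c s) (crossing_chain cV)).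
rewrite /= (crossing_parts cV) /parts /equivalence_partition -imset_comp.
apply/eqP/setP=> B; apply/imsetP/imsetP=> -[x _ ->].
  exists (s x) => //; apply/setP=> y; rewrite !inE /=.
  rewrite -[y in LHS](permKV s) (mem_imset _ _ (@perm_inj _ s)) !inE /=.
  by rewrite /linked !relof_act permK -(inj_eq (@perm_inj _ s)) permKV.
exists (s^-1 x)%g => //; apply/setP=> y; rewrite !inE /=.
rewrite -[y in RHS](permKV s) (mem_imset _ _ (@perm_inj _ s)) !inE /=.
by rewrite /linked !relof_act (inj_eq perm_inj).
Qed.

(** A crossing fixed by [s] is fixed by all of [<[s]>], so its order is invariant. Conversely an
    invariant order is fixed, and the parts follow. *)
Lemma card_fixed_crossings s :
  #|'Fix_(virtual_crossings n | crossing_action)[s]%g|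
    = #|chain_orders <[s]> [set: 'I_n]|.
Proof.
have sub1 R : chain_order <[s]> [set: 'I_n] (relof R) ->
    (parts R, R) \in virtual_crossings n.
  move=> rA; rewrite virtual_crossingE eqxx andbT.
  exact/chain_orderP/(chain_order_sub (sub1G _) rA).
apply: (@eq_card_cancel_in _ _ _ _ snd (fun R => (parts R, R)))
  => [c|R|c|R _ //].
- case/setIP=> cV /afix1P cs; rewrite inE; apply/chain_orderP.
  have /subsetP stab : <[s]>%g \subset 'C[c | crossing_action]%g.
    by rewrite cycle_subG; apply/astab1P.
  case: (crossing_chain cV) => *; split=> // h /stab /astab1P hc x y.
  by rewrite -{2}hc /= relof_act !permK.
- rewrite inE => /chain_orderP rA; have cV := sub1 _ rA.
  apply/setIP; split=> //; apply/afix1P.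
  (* The image is again a crossing, so its parts are determined by its order and only the orders
     need comparing. *)
  have aV := virtual_crossings_act s cV.
  have E : (crossing_act (parts R, R) s).2 = R.
    apply/setP=> -[u v]; rewrite -[LHS]/(relof _ u v) relof_act.
    by rewrite (chain_invE _ _ rA) ?groupV ?cycle_id.
  rewrite /= [LHS]surjective_pairing (crossing_parts aV) E //.
- by case/setIP=> /crossing_parts E _; rewrite -E -surjective_pairing.
Qed.

(** * The rotation group and the Burnside count *)

Definition rot : {perm 'I_n} := perm (@ordS_inj n).

Lemma rotXE r (i : 'I_n) : (rot ^+ r)%g i = shift r i.
Proof. by rewrite permX; apply: eq_iter => j; rewrite permE. Qed.

Lemma val_rotX r (i : 'I_n) : (rot ^+ r)%g i = (i + r) %% n :> nat.
Proof.
rewrite rotXE; elim: r => [|r IHr]; first by rewrite addn0 modn_small.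
rewrite /shift iterS /= -[iter _ _ _]/(shift r i) IHr.
by rewrite -addn1 modnDml -addnA addn1.
Qed.

Lemma rotX_fix r (i : 'I_n) : ((rot ^+ r)%g i == i) = (n %| r).
Proof.
rewrite -val_eqE /= val_rotX -{2}[val i](modn_small (ltn_ord i)).
by rewrite -[X in _ == X %% _]addn0 eqn_modDl mod0n.
Qed.

Lemma rotX_eq1 r : 0 < n -> ((rot ^+ r)%g == 1%g) = (n %| r).
Proof.
move=> n_gt0; apply/eqP/idP=> [rot1 | n_r].
  by rewrite -(rotX_fix r (Ordinal n_gt0)) rot1 perm1.
by apply/permP=> i; apply/eqP; rewrite perm1 rotX_fix.
Qed.

Lemma order_rot : 0 < n -> #[rot]%g = n.
Proof.
move=> n_gt0; apply/eqP; rewrite eqn_dvd.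
by rewrite order_dvdn rotX_eq1 // dvdnn -rotX_eq1 // expg_order eqxx.
Qed.

(** A power of [rot] that fixes one strand has an exponent divisible by [n], hence is the
    identity. *)
Lemma acts_freely_rotX k : acts_freely <[rot ^+ k]>.
Proof.
move=> h i /(subsetP (cycleX _ _))/cycleP[r ->] /eqP.
rewrite rotX_fix => n_r; apply/eqP; rewrite rotX_eq1 //.
exact: leq_ltn_trans (ltn_ord i).
Qed.

Lemma cycle_rotE : 0 < n -> <[rot]>%g = [set (rot ^+ k)%g | k : 'I_n].
Proof.
move=> n_gt0; apply/setP=> s; apply/idP/imsetP=> [/cyclePmin[k] | [k _ ->]].
  by rewrite order_rot // => kn ->; exists (Ordinal kn).
exact: mem_cycle.
Qed.

Lemma rotX_inj : injective (fun k : 'I_n => (rot ^+ k)%g).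
Proof.
move=> j k /eqP; rewrite eq_expg_mod_order order_rot; last first.
  exact: leq_ltn_trans (ltn_ord j).
by rewrite !modn_small // => /eqP/val_inj.
Qed.

Lemma rotate_crossingE r c : rotate_crossing r c = crossing_act c (rot ^+ r)%g.
Proof.
congr (_, _).
  by apply: eq_imset => B; apply: eq_imset => i; rewrite rotXE.
by apply: eq_imset => p; rewrite !rotXE.
Qed.

(** As [rot] has order [n], the exponents in ['I_n] exhaust the cyclic group, and the classes are
    its orbits. *)
Lemma rotation_classesE : 0 < n ->
  equivalence_partition (@rotation_equiv n) (virtual_crossings n)
    = orbit crossing_action <[rot]>%g @: virtual_crossings n.
Proof.
move=> n_gt0; apply: eq_in_imset => c cV; apply/setP=> d; rewrite inE.
rewrite /orbit cycle_rotE // -imset_comp.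
apply/andP/imsetP=> [[_ /existsP[r /eqP ->]] | [r _ ->]].
  by exists r => //; rewrite rotate_crossingE.
split; first exact: virtual_crossings_act.
by apply/existsP; exists r; rewrite rotate_crossingE.
Qed.

(** [rot ^+ k] generates a group of order [n %/ gcdn n k] acting freely, so there are [gcdn n k]
    orbits of strands; for [k = 0] this is the trivial group with [n] orbits. *)
Lemma card_fixed_rotX k : 0 < n ->
  #|'Fix_(virtual_crossings n | crossing_action)[rot ^+ k]%g|
    = N.to_nat (chain_counts (n %/ gcdn n k) (gcdn n k)).1.
Proof.
move=> n_gt0; have oE : #|<[rot ^+ k]>%g| = n %/ gcdn n k.
  by rewrite -orderE orderXgcd order_rot.
have [+ _] := card_chain_orders (gcdn n k) (@acts_freely_rotX k).
rewrite oE card_fixed_crossings; apply; first by move=> *; rewrite inE.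
by rewrite cardsT card_ord mulnC divnK // dvdn_gcdl.
Qed.

(** [Frobenius_Cauchy] is Burnside's lemma. The product form avoids division, and the sum over a
    list in [N] can be evaluated directly. *)
Lemma V_Burnside : 0 < n -> V n * n = N.to_nat (foldr N.add 0%num
  [seq (chain_counts (n %/ gcdn n k) (gcdn n k)).1 | k <- iota 0 n]).
Proof.
move=> n_gt0; rewrite /V rotation_classesE //.
rewrite -[X in _ * X](order_rot n_gt0) -Frobenius_Cauchy; last first.
  (* The crossings are stable under the action; the converse direction acts by the inverse of
     [s]. *)
  apply/actsP=> s _ c; apply/idP/idP; last exact: virtual_crossings_act.
  move/(virtual_crossings_act s^-1).
  rewrite -[crossing_act _ _]/(crossing_action _ _).
  by rewrite actK.
have memE s : (s \in <[rot]>%G) = (s \in [set (rot ^+ k)%g | k : 'I_n]).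
  by rewrite -cycle_rotE.
rewrite (eq_bigl _ _ memE) big_imset /=; last by move=> j k _ _; apply: rotX_inj.
under eq_bigr => k _ do rewrite card_fixed_rotX //.
rewrite -(big_mkord xpredT
  (fun k => N.to_nat (chain_counts (n %/ gcdn n k) (gcdn n k)).1)).
rewrite /index_iota subn0; elim: (iota 0 n) => [|k ks IHk].
  by rewrite big_nil.
by rewrite big_cons IHk N2Nat.inj_add.
Qed.

End Crossings.

(* A large literal is an application of [Nat.of_num_uint]; it is unfolded to its
   Horner form, which [lia] evaluates in binary. *)
Ltac decide_V :=
  match goal with |- V ?n = _ => have := @V_Burnside n isT end;
  rewrite /Nat.of_num_uint /Nat.of_uint; cbn [Nat.of_uint_acc];
  rewrite ?PeanoNat.Nat.tail_mul_spec;
  match goal with |- context [N.to_nat ?x] =>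
    let v := eval vm_compute in x in
    have -> : x = v by vm_compute end;
  rewrite -multE; lia.

Theorem corollary4p2 :
  V 2 = 2 /\ V 3 = 5 /\ V 4 = 20 /\ V 5 = 101 /\ V 6 = 684 /\
  V 7 = 5377 /\ V 8 = 49342 /\ V 9 = 510745 /\ V 10 = 5894550.
Proof. do 8?split; decide_V. Qed.
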